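(* Let $v_0>0$ and $0\le {\rm M}_-\le {\rm M}_+$ with $({\rm M}_-,{\rm M}_+)\neq(0,0)$. For each ${\rm M}\in\{{\rm M}_-,{\rm M}_+\}$ define on ${\mathbb Q}_{\rm M}={\mathbb Q}^\uparrow_{\rm M}\cup{\mathbb Q}^\downarrow_{\rm M}$ the function $$\theta_{\rm M}(d,f):=\begin{cases}\displaystyle \theta^\uparrow_{\rm M}(d,f):=2\sqrt{\frac{2d}{v_0}}\int_{-1}^{1}\frac{dx}{\sqrt{(1-x^2)\big(d^2x^2-4d{\rm M}x+4f-d^2\big)}} & \text{if }(d,f)\in{\mathbb Q}^\uparrow_{\rm M},\\[3mm] \displaystyle \theta^\downarrow_{\rm M}(d,f):=\sqrt{\frac{2d}{v_0}}\int_{0}^{2}\frac{dz}{\sqrt{z(2-z)\big({\rm M}^2z^2-2fz+d^2\big)}} & \text{if }(d,f)\in{\mathbb Q}^\downarrow_{\rm M}.\end{cases}$$ Then $\theta_{\rm M}$ is well-defined on ${\mathbb Q}_{\rm M}$ and, moreover, the Jacobi periods $\tau_+,\tau_-$ of the planar Euler problem satisfy $$\tau_+(d,f)=\theta_{{\rm M}_+}(d,f),\qquad \tau_-(d,f)=\theta_{{\rm M}_-}(d,f)\qquad\text{for all }(d,f)\in{\mathbb P}.$$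
   Context: Setting: the planar Euler (two fixed centers) problem with masses $M\ge m\ge0$, $(M,m)\ne(0,0)$, located at $-v_0\,\mathbf i$ and $v_0\,\mathbf i$ ($v_0>0$), and ${\rm M}_-=M-m$, ${\rm M}_+=M+m$. In confocal coordinates $\alpha\ge1$, $|\beta|\le1$ and Jacobi's regularized time $\tau$, the planar motions with energy ${\rm J}_0<0$ and separation constant ${\rm F}_0$ satisfy $(\alpha')^2=W_+(\alpha)$, $(\beta')^2=W_-(\beta)$ (prime is $d/d\tau$) with $$W_+(\alpha)=(\alpha^2-1)\big(2{\rm J}_0v_0^2\alpha^2+2{\rm M}_+v_0\alpha-(2{\rm J}_0v_0^2+{\rm F}_0)\big),\qquad W_-(\beta)=(1-\beta^2)\big(-2{\rm J}_0v_0^2\beta^2-2{\rm M}_-v_0\beta+(2{\rm J}_0v_0^2+{\rm F}_0)\big).$$ Parameters: $d:=-4v_0{\rm J}_0$ and $f:=-2{\rm J}_0{\rm F}_0$ (so, for $d>0$, ${\rm J}_0=-d/(4v_0)$ and ${\rm F}_0=2v_0f/d$). Jacobi periods: $$\tau_+(d,f)=2\int_{\alpha_{\min}}^{\alpha_{\max}}\frac{d\alpha}{\sqrt{W_+(\alpha)}},\qquad \tau_-(d,f)=2\int_{\beta_{\min}}^{\beta_{\max}}\frac{d\beta}{\sqrt{W_-(\beta)}},$$ where $[\alpha_{\min},\alpha_{\max}]$ is the nondegenerate interval of $\{\alpha\ge1: W_+(\alpha)\ge0\}$ and $[\beta_{\min},\beta_{\max}]$ is a nondegenerate connected component of $\{\beta\in[-1,1]: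 W_-(\beta)\ge0\}$ (when there are two such components they give the same value of $\tau_-$). For ${\rm M}\ge0$ and $d>0$ put $$f^-_{\rm M}(d)=-{\rm M}d,\quad f^{\rm s}_{\rm M}(d)=\begin{cases}{\rm M}d&0<d\le2{\rm M}\\ {\rm M}^2+\frac{d^2}{4}&d>2{\rm M}\end{cases},\quad f^+_{\rm M}(d)=\begin{cases}{\rm M}^2+\frac{d^2}{4}&0<d\le2{\rm M}\\ {\rm M}d&d>2{\rm M}.\end{cases}$$ Domains: $${\mathbb P}=\{(d,f)\in{\mathbb R}^2:\ d>0,\ f^-_{{\rm M}_-}(d)<f<f^+_{{\rm M}_+}(d),\ f\ne f^{\rm s}_{{\rm M}_-}(d),\ f\ne f^{\rm s}_{{\rm M}_+}(d)\},$$ $${\mathbb Q}_{\rm M}=\{(d,f)\in{\mathbb R}^2:\ d>0,\ f>f^-_{\rm M}(d),\ f\ne f^{\rm s}_{\rm M}(d)\},$$ ${\mathbb Q}^\uparrow_{\rm M}=\{(d,f)\in{\mathbb Q}_{\rm M}: f>f^{\rm s}_{\rm M}(d)\}$, ${\mathbb Q}^\downarrow_{\rm M}=\{(d,f)\in{\mathbb Q}_{\rm M}: f<f^{\rm s}_{\rm M}(d)\}$. One has ${\mathbb P}\subset{\mathbb Q}_{{\rm M}_+}\cap{\mathbb Q}_{{\rm M}_-}$. ''Well-defined'' means that the expression under the square root is positive in the open interval of integration and the integral converges. *)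

(* Defs.v *)
From HB Require Import structures.
From mathcomp Require Import all_boot all_order all_algebra.
From mathcomp Require Import all_classical all_reals all_analysis.

Set Implicit Arguments.
Unset Strict Implicit.
Unset Printing Implicit Defensive.

Import Order.TTheory GRing.Theory Num.Theory.
Import numFieldNormedType.Exports.

Local Open Scope classical_set_scope.
Local Open Scope ring_scope.

Section Integrals.
Context {R : realType}.

(* Lebesgue and improper Riemann integrals agree here: the integrand is
   nonnegative, and the value +oo is divergence. *)
Definition inv_sqrt_integral (W : R -> R) (a b : R) : \bar R :=
  (\int[lebesgue_measure]_(x in `]a, b[) ((Num.sqrt (W x))^-1)%:E)%E.

Definition well_defined (W : R -> R) (a b : R) : Prop :=
  (forall x, a < x < b -> 0 < W x) /\
  lebesgue_measure.-integrable `]a, b[ (fun x => ((Num.sqrt (W x))^-1)%:E).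

Definition nondegenerate_component (S : set R) (a b : R) : Prop :=
  a < b /\ connected_component S a = [set` `[a, b]].

End Integrals.

Section Euler.
Context {R : realType}.
Implicit Types M Mm Mp d f : R.

Definition Wplus (v0 Mp J0 F0 al : R) : R :=
  (al ^+ 2 - 1) *
  (2 * J0 * v0 ^+ 2 * al ^+ 2 + 2 * Mp * v0 * al - (2 * J0 * v0 ^+ 2 + F0)).

Definition Wminus (v0 Mm J0 F0 be : R) : R :=
  (1 - be ^+ 2) *
  (- 2 * J0 * v0 ^+ 2 * be ^+ 2 - 2 * Mm * v0 * be + (2 * J0 * v0 ^+ 2 + F0)).

(* These invert d = - 4 v0 J0 and f = - 2 J0 F0. *)
Definition J0_of (v0 : R) d : R := - d / (4 * v0).
Definition F0_of (v0 : R) d f : R := 2 * v0 * f / d.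

Definition Wp (v0 : R) Mp d f : R -> R := Wplus v0 Mp (J0_of v0 d) (F0_of v0 d f).
Definition Wm (v0 : R) Mm d f : R -> R := Wminus v0 Mm (J0_of v0 d) (F0_of v0 d f).

Definition alpha_set (v0 : R) Mp d f : set R :=
  [set al | 1 <= al /\ 0 <= Wp v0 Mp d f al].
Definition beta_set (v0 : R) Mm d f : set R :=
  [set be | -1 <= be <= 1 /\ 0 <= Wm v0 Mm d f be].

(* alpha_set may also have the isolated point 1, whence "nondegenerate". *)
Definition is_tau_plus (v0 : R) Mp d f (t : \bar R) : Prop :=
  exists a b : R,
    [/\ forall a' b', nondegenerate_component (alpha_set v0 Mp d f) a' b' <->
                      a' = a /\ b' = b,
        well_defined (Wp v0 Mp d f) a b
      & t = (2%:E * inv_sqrt_integral (Wp v0 Mp d f) a b)%E].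

(* beta_set may have two nondegenerate components; t must be the value given
   by every one of them. *)
Definition is_tau_minus (v0 : R) Mm d f (t : \bar R) : Prop :=
  (exists a b : R, nondegenerate_component (beta_set v0 Mm d f) a b) /\
  (forall a b : R, nondegenerate_component (beta_set v0 Mm d f) a b ->
     well_defined (Wm v0 Mm d f) a b /\
     t = (2%:E * inv_sqrt_integral (Wm v0 Mm d f) a b)%E).

Definition f_minus M d : R := - M * d.
Definition f_sep M d : R :=
  if d <= 2 * M then M * d else M ^+ 2 + d ^+ 2 / 4.
Definition f_plus M d : R :=
  if d <= 2 * M then M ^+ 2 + d ^+ 2 / 4 else M * d.

Definition PP Mm Mp : set (R * R) :=
  [set p | [/\ 0 < p.1, f_minus Mm p.1 < p.2 < f_plus Mp p.1,
               p.2 <> f_sep Mm p.1 & p.2 <> f_sep Mp p.1]].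

Definition QQ M : set (R * R) :=
  [set p | [/\ 0 < p.1, f_minus M p.1 < p.2 & p.2 <> f_sep M p.1]].

Definition QQup M : set (R * R) := QQ M `&` [set p | f_sep M p.1 < p.2].
Definition QQdown M : set (R * R) := QQ M `&` [set p | p.2 < f_sep M p.1].

Definition up_radicand M d f (x : R) : R :=
  (1 - x ^+ 2) * (d ^+ 2 * x ^+ 2 - 4 * d * M * x + 4 * f - d ^+ 2).
Definition down_radicand M d f (z : R) : R :=
  z * (2 - z) * (M ^+ 2 * z ^+ 2 - 2 * f * z + d ^+ 2).

Definition theta_up (v0 : R) M d f : \bar R :=
  ((2 * Num.sqrt (2 * d / v0))%:E *
   inv_sqrt_integral (up_radicand M d f) (-1) 1)%E.
Definition theta_down (v0 : R) M d f : \bar R :=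
  ((Num.sqrt (2 * d / v0))%:E *
   inv_sqrt_integral (down_radicand M d f) 0 2)%E.

(* Only meaningful on QQ M, where the two branches are exhaustive. *)
Definition theta (v0 : R) M d f : \bar R :=
  if (d, f) \in QQup M then theta_up v0 M d f else theta_down v0 M d f.

Definition theta_well_defined M d f : Prop :=
  if (d, f) \in QQup M then well_defined (up_radicand M d f) (-1) 1
  else well_defined (down_radicand M d f) 0 2.

Lemma QQE M : QQ M = QQup M `|` QQdown M.
Proof.
apply/seteqP; split=> [p Qp|p [] []//].
have [_ _ /eqP] := Qp.
by rewrite neq_lt => /orP[] h; [right|left].
Qed.

End Euler.

(* Main.v *)
Require Import Defs.
From mathcomp Require Import all_boot all_order all_algebra.
From mathcomp Require Import all_classical all_reals all_analysis.
From mathcomp Require Import measurable_realfun ring lra.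
Import Order.TTheory GRing.Theory Num.Theory.
Import numFieldNormedType.Exports.
Local Open Scope classical_set_scope.
Local Open Scope ring_scope.

(** Up to the factor k = v0 / (2 d), both radicands W_+ and W_- are one and the
    same quartic U(x) = (1 - x^2) q(x), where
    q(x) = d^2 x^2 - 4 d M x + 4 f - d^2, with M = M_+ for the first and
    M = M_- for the second.  All the integrals involved, those defining the
    Jacobi periods as well as those defining theta, thus have the shape
    int_a^b dx / sqrt ((x - a) (b - x) Q(x)) with Q a quadratic polynomial that
    is positive on [a, b].

    Such an integral depends on two numbers only.  The substitution
    x = (a c + b u^2) / (c + u^2) with c = Q(b) turns it into 2 P(m, n), where
    P(m, n) = int_0^oo du / sqrt (u^4 + m u^2 + n), n = Q(a) Q(b), and m is
    twice the polar form of Q at (a, b); this is [inv_sqrt_integral_quartic].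
    Two integrals between different pairs of roots of a quartic agree as soon
    as their invariants (m, n) agree, and comparing invariants is polynomial
    algebra in the roots e1 < e2 of q:
    - for f above the separatrix value, the interval [-1, 1] that defines theta
      is itself the beta interval, and it has the same invariants as the alpha
      interval [e1, e2];
    - for f below it, the intervals [-1, e1], [e2, 1] (when e2 < 1) and [1, e2]
      (when 1 < e2) have common invariants, but these are not the invariants of
      the integral over z in [0, 2] that defines theta, since for |f| < M d
      the quadratic factor of that radicand has no real root.  The two sides are
      related by a Landen transformation w = u - r / u, which gives
      P(m, r^2) = 2 P(m + 6 r, 4 r (m + 2 r)); this is
      [biquadratic_period_landen].

    Convergence follows by comparison with the case Q = 1, where P(2, 1) is the
    integral of 1 / (1 + u^2).  It remains to locate e1 and e2 with respect to
    -1 and 1, which determines the allowed sets of alpha and beta, hence their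
    connected components. *)

(** * Change of variables from the half-line *)

(** On the compact pieces [1/(n+1), n+1] of the half-line this is the usual
    change of variables; the integrands may blow up at the ends of the
    intervals, and nonnegativity allows the pieces to be exhausted by monotone
    convergence. *)
Lemma ge0_substitution_halfline (R : realType) (F F' G : R -> R)
    (i : interval R) :
  (forall t : R, 0 < t -> is_derive t 1 F (F' t)) ->
  (forall t : R, 0 < t -> 0 < F' t) ->
  (forall t : R, 0 < t -> {for t, continuous F'}) ->
  F @` `]0, +oo[%classic = [set` i] -> open [set` i] ->
  (forall x, x \in i -> {for x, continuous G}) ->
  (forall x, x \in i -> 0 <= G x) ->
  (\int[lebesgue_measure]_(x in [set` i]) (G x)%:E =
   \int[lebesgue_measure]_(t in `]0%R, +oo[) (G (F t) * F' t)%:E)%E.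
Proof.
move=> dF F'0 cF' Fi oi cG G0.
pose a n : R := n.+1%:R^-1; pose b n : R := n.+1%:R.
have a0 n : 0 < a n by rewrite invr_gt0.
have ab n : a n <= b n.
  by rewrite (@le_trans _ _ 1) ?invf_le1 ?ler1n.
have cF (t : R) : 0 < t -> {for t, continuous F}.
  move=> t0; apply/differentiable_continuous/derivable1_diffP.
  by case: (dF t t0).
have iF (t : R) : 0 < t -> F t \in i.
  move=> t0; suff : [set` i] (F t) by [].
  by rewrite -Fi; exists t => //=; rewrite in_itv/= t0.
have incF : {in `]0, +oo[ &, {homo F : x y / x < y}}.
  move=> x y /[!in_itv]/= /andP[x0 _] /andP[y0 _] xy.
  have [z /[!in_itv]/= /andP[xz _]] : exists2 c, c \in `]x, y[%R &
      F y - F x = F' c * (y - x).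
    apply: MVT => //.
      by move=> z /[!in_itv]/= /andP[xz _]; apply: dF; exact: lt_trans xz.
    apply: continuous_in_subspaceT => z /[!inE]/= /[!in_itv]/= /andP[xz _].
    by apply: cF; exact: lt_le_trans xz.
  have z0 := lt_trans x0 xz.
  by move=> e; rewrite -subr_gt0 e mulr_gt0 ?F'0 ?subr_gt0.
have F'E (t : R) : 0 < t -> derive1 F t = F' t.
  by move=> t0; rewrite derive1E; apply: derive_val; exact: dF.
have F'near (t : R) : 0 < t -> \forall x \near t, F' x = derive1 F x.
  move=> t0; near=> x; rewrite F'E//.
  by near: x; exact: lt_nbhsr.
have cdF (t : R) : 0 < t -> {for t, continuous (derive1 F)}.
  move=> t0; rewrite /prop_for /continuous_at F'E//.
  have := cF' t t0; rewrite /prop_for /continuous_at.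
  by apply: cvg_trans; apply: near_eq_cvg; exact: F'near.
have Fmono : {in `]0, +oo[ &, {mono F : x y / x <= y}}.
  exact: le_mono_in.
have mono n m : (n <= m)%N -> a m <= a n /\ b n <= b m.
  by move=> nm; rewrite /a /b lef_pV2 ?posrE// !ler_nat !ltnS.
have b0 n : 0 < b n by rewrite ltr0n.
have pos (t : R) : 0 < t -> t \in `]0, +oo[%R by rewrite in_itv/= andbT.
have absorb (t : R) : 0 < t -> exists n, a n <= t <= b n.
  move=> t0; have := archi_boundP (ltW t0).
  have : 0 <= t^-1 by rewrite invr_ge0 ltW.
  move/archi_boundP; set k := Num.bound _; set l := Num.bound t => tk tl.
  exists (k + l)%N; rewrite /a /b; apply/andP; split; last first.
    by rewrite (le_trans (ltW tl))// ler_nat leqW// leq_addl.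
  rewrite -[leRHS]invrK lef_pV2 ?posrE ?invr_gt0//.
  by rewrite (le_trans (ltW tk))// ler_nat leqW// leq_addr.
have part n : (\int[lebesgue_measure]_(x in `[F (a n), F (b n)]) (G x)%:E =
   \int[lebesgue_measure]_(t in `[a n, b n]) (G (F t) * F' t)%:E)%E.
  have itvpos (x : R) : x \in `[a n, b n] -> 0 < x.
    by rewrite in_itv/= => /andP[ax _]; exact: lt_le_trans ax.
  have itvopos (x : R) : x \in `]a n, b n[ -> 0 < x.
    by rewrite in_itv/= => /andP[ax _]; exact: lt_trans ax.
  rewrite integration_by_substitution_increasing//.
  - apply: eq_integral => x /[!inE] xab /=.
    by rewrite !fctE F'E//; exact: itvpos.
  - by move=> x y /itvpos x0 /itvpos y0; apply: incF; exact: pos.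
  - by move=> x /itvopos/cdF.
  - apply/cvg_ex; exists (derive1 F (a n)).
    by apply: cvg_at_right_filter; exact: cdF.
  - apply/cvg_ex; exists (derive1 F (b n)).
    by apply: cvg_at_left_filter; exact: cdF.
  - split.
    + by move=> x /itvopos x0; case: (dF x x0).
    + by apply: cvg_at_right_filter; exact: cF.
    + by apply: cvg_at_left_filter; exact: cF.
  - apply: continuous_in_subspaceT => x /[!inE]/= /[!in_itv]/= /andP[ax xb].
    apply: cG; apply: (interval_is_interval (iF _ (a0 n)) (iF _ (b0 n))).
    by rewrite ax.
have mGi : measurable_fun [set` i] G.
  by apply: open_continuous_measurable_fun => // x /[!inE]; exact: cG.
have mGF : measurable_fun (`]0, +oo[%classic : set R) (fun t => G (F t) * F' t).
  apply: open_continuous_measurable_fun; first exact: interval_open.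
  move=> x /[!inE]/= /[!in_itv]/= /andP[x0 _].
  apply: continuousM; last exact: cF'.
  by apply: continuous_comp; [exact: cF|exact/cG/iF].
have UI : \bigcup_n `[F (a n), F (b n)]%classic = [set` i].
  apply/seteqP; split=> [x [n _ /=]|x].
    rewrite in_itv/= => ax.
    exact: (interval_is_interval (iF _ (a0 n)) (iF _ (b0 n)) ax).
  rewrite -Fi => -[t /= /[!in_itv]/= /andP[t0 _] <-].
  have [n /andP[ant tbn]] := absorb _ t0.
  by exists n => //=; rewrite in_itv/= !Fmono ?pos ?ant.
have UT : \bigcup_n `[a n, b n]%classic = `]0, +oo[%classic.
  apply/seteqP; split=> [x [n _ /=]|x /=]; rewrite !in_itv/= ?andbT.
    by move=> /andP[ax _]; exact: lt_le_trans ax.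
  by move=> /absorb[n anb]; exists n.
have subI n : `[F (a n), F (b n)]%classic `<=` [set` i].
  by rewrite -UI => x xn; exists n.
have subT n : `[a n, b n]%classic `<=` `]0, +oo[%classic.
  by rewrite -UT => x xn; exists n.
have limI : (
   \int[lebesgue_measure]_(x in `[F (a n), F (b n)]) (G x)%:E @[n --> \oo]
   --> \int[lebesgue_measure]_(x in [set` i]) (G x)%:E)%E.
  rewrite -UI; apply: ge0_nondecreasing_set_cvg_integral.
  - move=> n m /mono[amn bnm]; apply/subsetPset/subset_itv;
      rewrite bnd_simp Fmono//; exact: pos.
  - by [].
  - move=> n; apply/measurable_EFinP; exact: measurable_funS mGi.
  - by move=> n x /subI xi; rewrite lee_fin G0.
have limT : (
   \int[lebesgue_measure]_(t in `[a n, b n]) (G (F t) * F' t)%:E @[n --> \oo]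
   --> \int[lebesgue_measure]_(t in `]0%R, +oo[) (G (F t) * F' t)%:E)%E.
  rewrite -UT; apply: ge0_nondecreasing_set_cvg_integral.
  - by move=> n m /mono[amn bnm]; apply/subsetPset/subset_itv; rewrite bnd_simp.
  - by [].
  - move=> n; apply/measurable_EFinP; exact: measurable_funS mGF.
  - move=> n x /subT /=; rewrite in_itv/= andbT => x0.
    by rewrite lee_fin mulr_ge0 ?G0 ?iF// ltW ?F'0.
move: limI; rewrite (eq_cvg _ _ part) => limI.
by apply: cvg_unique limI limT; exact: ereal_hausdorff.
Unshelve. all: end_near.
Qed.

(** * Reduction of quartic periods to a canonical form *)

Definition quad {R : realType} (p q s x : R) : R := p * x ^+ 2 + q * x + s.

(** Twice the symmetric bilinear form of the homogenized quadratic
    polynomial, at the points (a, 1) and (b, 1); this is the coefficient of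
    u^2 after the substitution of [inv_sqrt_integral_quartic]. *)
Definition polar {R : realType} (p q s a b : R) : R :=
  2 * p * a * b + q * (a + b) + 2 * s.

Definition biquadratic {R : realType} (m n u : R) : R :=
  u ^+ 4 + m * u ^+ 2 + n.

Definition biquadratic_period {R : realType} (m n : R) : \bar R :=
  (\int[lebesgue_measure]_(u in `]0%R, +oo[)
     ((Num.sqrt (biquadratic m n u))^-1)%:E)%E.

Lemma quad_continuous (R : realType) (p q s : R) : continuous (quad p q s).
Proof.
move=> x; apply: cvgD; last exact: cvg_cst.
apply: cvgD; apply: cvgM; try exact: cvg_cst; last exact: cvg_id.
exact: exprn_continuous.
Qed.

Lemma biquadratic_continuous (R : realType) (m n : R) :
  continuous (biquadratic m n).
Proof.
move=> x; apply: cvgD; last exact: cvg_cst.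
apply: cvgD; first exact: exprn_continuous.
by apply: cvgM; [exact: cvg_cst|exact: exprn_continuous].
Qed.

Lemma continuous_inv_sqrt (R : realType) (W : R -> R) (x : R) :
  {for x, continuous W} -> 0 < W x ->
  {for x, continuous (fun y => (Num.sqrt (W y))^-1)}.
Proof.
move=> cW W0; apply: continuousV; first by rewrite gt_eqF// sqrtr_gt0.
by apply: continuous_comp; [exact: cW|exact: sqrt_continuous].
Qed.

Lemma measurable_inv_sqrt_biquadratic (R : realType) (D : set R) (m n : R) :
  open D -> (forall u, D u -> 0 < biquadratic m n u) ->
  measurable_fun D (fun u => (Num.sqrt (biquadratic m n u))^-1).
Proof.
move=> oD B0; apply: open_continuous_measurable_fun => // u /[!inE] Du.
by apply: continuous_inv_sqrt; [exact: biquadratic_continuous|exact: B0].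
Qed.

Lemma continuous_quartic (R : realType) (a b p q s : R) :
  continuous (fun x => (x - a) * (b - x) * quad p q s x).
Proof.
move=> x; apply: cvgM; last exact: quad_continuous.
by apply: cvgM; apply: cvgB; try exact: cvg_cst; exact: cvg_id.
Qed.

(** The substitution x = (a c + b u^2) / (c + u^2) sends the half-line onto the
    interval, and (x - a) (b - x) becomes the square of a rational function, so
    that only the numerator of Q is left under the root.  The choice c = Q(b)
    makes that numerator monic up to a factor c, and the length b - a
    cancels. *)
Lemma inv_sqrt_integral_quartic (R : realType) (a b p q s : R) :
  a < b -> (forall x, a <= x <= b -> 0 < quad p q s x) ->
  inv_sqrt_integral (fun x => (x - a) * (b - x) * quad p q s x) a b =
  (2%:E * biquadratic_period (polar p q s a b)
            (quad p q s a * quad p q s b))%E.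
Proof.
move=> ab Q0; set m := polar _ _ _ _ _; set c := quad p q s b; set n := _ * _.
have Qb0 : 0 < c by apply: Q0; rewrite lexx ltW.
(* F u = (a c + b u^2) / (c + u^2), written so as to ease differentiation. *)
pose F u : R := b - (b - a) * c * (c + u ^+ 2)^-1.
pose F' u : R := 2 * (b - a) * c * u / (c + u ^+ 2) ^+ 2.
have ba0 : 0 < b - a by rewrite subr_gt0.
have cu0 u : 0 < c + u ^+ 2 by rewrite ltr_wpDr// sqr_ge0.
have F'0 u : 0 < u -> 0 < F' u.
  by move=> u0; rewrite /F' !(mulr_gt0, invr_gt0, exprn_gt0).
have FE u : 0 < u -> (F u - a) * (b - F u) * quad p q s (F u) =
    (F' u / 2) ^+ 2 * biquadratic m n u.
  move=> u0; rewrite /F /F' /biquadratic /m /n /polar /quad -/(quad p q s b).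
  have := cu0 u; rewrite /c /quad => c0.
  by field; rewrite gt_eqF.
have Fab u : 0 < u -> a < F u < b.
  move=> u0; rewrite /F gtrBl !mulr_gt0 ?invr_gt0// andbT ltrBrDl -ltrBrDr.
  by rewrite -mulrA gtr_pMr// ltr_pdivrMr// mul1r ltrDl exprn_gt0.
have W0 x : a < x < b -> 0 < (x - a) * (b - x) * quad p q s x.
  by move=> /andP[ax xb]; rewrite !mulr_gt0 ?subr_gt0// Q0// !ltW.
have B0 u : 0 < u -> 0 < biquadratic m n u.
  move=> u0; have := W0 _ (Fab u u0).
  by rewrite FE// pmulr_rgt0// exprn_gt0// divr_gt0// F'0.
have dF (u : R) : 0 < u -> is_derive u 1 F (F' u).
  move=> u0; rewrite /F.
  have ? : is_derive u 1 (fun u => (c + u ^+ 2)^-1)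
      (- (2 * u) / (c + u ^+ 2) ^+ 2).
    have dcu : is_derive u 1 (fun u => c + u ^+ 2) (2 * u).
      by apply: is_derive_eq; rewrite /GRing.scale/=; ring.
    apply: (is_derive_eq (is_deriveV _ dcu)); first by rewrite gt_eqF.
    by rewrite /GRing.scale/=; ring.
  apply: is_derive_eq; rewrite /GRing.scale/= /F'; ring.
rewrite /inv_sqrt_integral.
rewrite (@ge0_substitution_halfline R F F' _ _ dF F'0); first last.
- by move=> x _; rewrite invr_ge0 sqrtr_ge0.
- move=> x /[!in_itv]/= xab; apply: continuous_inv_sqrt; last exact: W0.
  exact: continuous_quartic.
- exact: interval_open.
- apply/seteqP; split=> [_ [u /= /[!in_itv]/= /andP[u0 _] <-]|x /=].
    exact: Fab.
  rewrite in_itv/= => /andP[ax xb].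
  have xa0 : 0 < x - a by rewrite subr_gt0.
  have bx0 : 0 < b - x by rewrite subr_gt0.
  have k0 : 0 < c * (x - a) / (b - x) by rewrite divr_gt0// mulr_gt0.
  exists (Num.sqrt (c * (x - a) / (b - x))).
    by rewrite /= in_itv/= sqrtr_gt0 k0.
  rewrite /F sqr_sqrtr ?(ltW k0)//; field.
  by rewrite (gt_eqF bx0) (_ : _ + _ = c * (b - a)) ?gt_eqF ?mulr_gt0//; ring.
- move=> u u0; apply: cvgM.
    by apply: cvgM; [exact: cvg_cst|exact: cvg_id].
  apply: cvgV; first by rewrite gt_eqF// exprn_gt0.
  have cu : (fun u => c + u ^+ 2) x @[x --> u] --> c + u ^+ 2.
    by apply: cvgD; [exact: cvg_cst|exact: exprn_continuous].
  exact: (cvg_comp _ (fun y => y ^+ 2) cu (@exprn_continuous _ 2 (c + u ^+ 2))).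
rewrite /biquadratic_period -ge0_integralZl_EFin//=; first last.
- apply/measurable_EFinP.
  apply: measurable_inv_sqrt_biquadratic; first exact: interval_open.
  by move=> u /=; rewrite in_itv/= andbT => /B0.
apply: eq_integral => u /[!inE]/= /[!in_itv]/= /andP[u0 _].
rewrite FE// -EFinM; congr EFin.
have F20 : 0 < F' u / 2 by rewrite divr_gt0 ?F'0.
rewrite sqrtrM ?sqr_ge0// sqrtr_sqr gtr0_norm// invfM.
have s0 : 0 < Num.sqrt (biquadratic m n u) by rewrite sqrtr_gt0 B0.
by field; rewrite (gt_eqF s0) gt_eqF// F'0.
Qed.

Lemma biquadratic_gt0 (R : realType) (m r u : R) :
  0 < r -> 0 < m + 2 * r -> 0 < biquadratic m (r ^+ 2) u.
Proof.
move=> r0 mr0; have -> : biquadratic m (r ^+ 2) u =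
    (u ^+ 2 - r) ^+ 2 + (m + 2 * r) * u ^+ 2 by rewrite /biquadratic; ring.
have [->|u0] := eqVneq u 0.
  by rewrite expr0n mulr0 addr0 sub0r sqrrN exprn_gt0.
by rewrite ltr_wpDl ?sqr_ge0// mulr_gt0// lt0r sqrf_eq0 u0 sqr_ge0.
Qed.

(** Landen's transformation.  With w = u - r / u one has
    u^2 + r^2 / u^2 = w^2 + 2 r and (u + r / u)^2 = w^2 + 4 r, so that
    du / sqrt (u^4 + m u^2 + r^2) becomes
    dw / sqrt ((w^2 + 4 r) (w^2 + m + 2 r)).  As u runs over the half-line, w
    runs over the whole line, and evenness in w accounts for the factor 2. *)
Lemma biquadratic_period_landen (R : realType) (m r : R) :
  0 < r -> 0 < m + 2 * r ->
  biquadratic_period m (r ^+ 2) =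
  (2%:E * biquadratic_period (m + 6 * r) (4 * r * (m + 2 * r)))%E.
Proof.
move=> r0 mr0; set m' := m + 6 * r; set n' := 4 * r * _.
have B0 u : 0 < biquadratic m (r ^+ 2) u by exact: biquadratic_gt0.
have B'E w : biquadratic m' n' w = (w ^+ 2 + 4 * r) * (w ^+ 2 + (m + 2 * r)).
  by rewrite /biquadratic /m' /n'; ring.
have B'0 w : 0 < biquadratic m' n' w.
  by rewrite B'E mulr_gt0// ltr_wpDl ?sqr_ge0// mulr_gt0.
pose H w : R := (Num.sqrt (biquadratic m' n' w))^-1.
have H0 w : 0 <= H w by rewrite invr_ge0 sqrtr_ge0.
have cH : continuous H.
  by move=> w; apply: continuous_inv_sqrt => //; exact: biquadratic_continuous.
pose F u : R := u - r * u^-1.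
pose F' u : R := 1 + r * u ^- 2.
have F'0 u : 0 < u -> 0 < F' u.
  by move=> u0; rewrite addr_gt0// mulr_gt0// invr_gt0 exprn_gt0.
have dF (u : R) : 0 < u -> is_derive u 1 F (F' u).
  move=> u0; have ? : is_derive u 1 (fun u : R => u^-1) (- u ^- 2).
    apply: (is_derive_eq (is_deriveV _ (is_derive_id u 1))).
      by rewrite gt_eqF.
    by rewrite /GRing.scale/= mulr1.
  by apply: is_derive_eq; rewrite /GRing.scale/= /F'; ring.
have FE u : 0 < u ->
    biquadratic m' n' (F u) = F' u ^+ 2 * biquadratic m (r ^+ 2) u.
  move=> u0; rewrite /F /F' /biquadratic /m' /n'.
  by field; rewrite gt_eqF.
transitivity (\int[lebesgue_measure]_x (H x)%:E)%E.
  rewrite -set_itvNyy.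
  rewrite (@ge0_substitution_halfline R F F' _ _ dF F'0)//; first last.
  - by move=> x _; exact: cH.
  - rewrite set_itvNyy; apply/seteqP; split=> // w _ /=.
    have k0 : 0 <= w ^+ 2 + 4 * r by rewrite addr_ge0 ?sqr_ge0// mulr_ge0 ?ltW.
    (* The positive root of u^2 - w u - r = 0. *)
    pose u := (w + Num.sqrt (w ^+ 2 + 4 * r)) / 2.
    have u0 : 0 < u.
      rewrite divr_gt0// -ltrBlDl sub0r (le_lt_trans (ler_norm _))// normrN.
      rewrite -sqrtr_sqr ltr_sqrt ?ltrDl ?mulr_gt0//.
      by rewrite ltr_wpDl ?sqr_ge0// mulr_gt0.
    exists u; first by rewrite in_itv/= u0.
    have uE : u * (u - w) = r.
      have := sqr_sqrtr k0; rewrite /u; set S := Num.sqrt _ => SE.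
      rewrite (_ : _ * _ = (S ^+ 2 - w ^+ 2) / 4); first by rewrite SE; field.
      by field.
    by rewrite /F -uE; field; rewrite gt_eqF.
  - move=> u u0; apply: cvgD; first exact: cvg_cst.
    apply: cvgM; first exact: cvg_cst.
    by apply: cvgV; [rewrite gt_eqF// exprn_gt0|exact: exprn_continuous].
  apply: eq_integral => u /[!inE]/= /[!in_itv]/= /andP[u0 _].
  congr EFin; rewrite /H FE// sqrtrM ?sqr_ge0// sqrtr_sqr gtr0_norm ?F'0//.
  by rewrite invfM mulrAC mulVf ?mul1r// gt_eqF// F'0.
rewrite ge0_symfun_integralT//; last first.
  by move=> w; rewrite /H /= /biquadratic sqrrN exprNn -signr_odd expr0 mul1r.
rewrite -set_itvcy -integral_itv_obnd_cbnd//.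
apply/measurable_EFinP; apply: measurable_inv_sqrt_biquadratic => //.
Qed.

Lemma biquadratic_period21 (R : realType) :
  biquadratic_period 2 1 = (pi / 2)%:E :> \bar R.
Proof.
rewrite -integral0y_oneDsqr -integral_itv_obnd_cbnd.
  apply: eq_integral => u _; congr (_^-1)%:E.
  rewrite (_ : biquadratic _ _ _ = (oneDsqr u) ^+ 2).
    by rewrite sqrtr_sqr ger0_norm// addr_ge0// sqr_ge0.
  by rewrite /biquadratic /oneDsqr; ring.
apply/measurable_EFinP; apply: measurable_funS measurableT _ _ => //.
by apply: continuous_measurable_fun; exact: continuous_oneDsqrV.
Qed.

(** By compactness Q is bounded below by a positive constant on [a, b], which
    reduces convergence to the case Q = 1, where the integral is pi. *)
Lemma well_defined_quartic (R : realType) (a b p q s : R) :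
  a < b -> (forall x, a <= x <= b -> 0 < quad p q s x) ->
  well_defined (fun x => (x - a) * (b - x) * quad p q s x) a b.
Proof.
move=> ab Q0.
pose g (x : R) := (Num.sqrt ((x - a) * (b - x) * quad 0 0 1 x))^-1.
have one0 (x : R) : 0 < quad 0 0 1 x by rewrite /quad !mul0r !add0r.
have meas p' q' s' : (forall x, a <= x <= b -> 0 < quad p' q' s' x) ->
  (forall x, a < x < b -> 0 < (x - a) * (b - x) * quad p' q' s' x) /\
  measurable_fun (`]a, b[%classic : set R)
    (fun x => (Num.sqrt ((x - a) * (b - x) * quad p' q' s' x))^-1).
  move=> Q'0; have W0 x : a < x < b -> 0 < (x - a) * (b - x) * quad p' q' s' x.
    by move=> /andP[ax xb]; rewrite !mulr_gt0 ?subr_gt0// Q'0// !ltW.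
  split=> //; apply: open_continuous_measurable_fun; first exact: interval_open.
  move=> x /[!inE]/= /[!in_itv]/= xab.
  apply: (@continuous_inv_sqrt _ (fun x => (x - a) * (b - x) * quad p' q' s' x)).
    exact: continuous_quartic.
  exact: W0.
have [W0 mW] := meas _ _ _ Q0.
have [V0 mV] := meas _ _ _ (fun x _ => one0 x).
split=> //.
have [c cab cmin] : exists2 c, c \in `[a, b]%R &
    forall t, t \in `[a, b]%R -> quad p q s c <= quad p q s t.
  apply: EVT_min; first exact: ltW.
  by apply: continuous_subspaceT; exact: quad_continuous.
have k0 : 0 < quad p q s c by apply: Q0; rewrite in_itv/= in cab.
have ig : lebesgue_measure.-integrable `]a, b[ (fun x => (g x)%:E).
  apply/integrableP; split; first exact/measurable_EFinP.
  have -> : (\int[lebesgue_measure]_(x in `]a, b[) `|(g x)%:E|)%E =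
      inv_sqrt_integral (fun x => (x - a) * (b - x) * quad 0 0 1 x) a b.
    by apply: eq_integral => x _; rewrite gee0_abs// lee_fin invr_ge0 sqrtr_ge0.
  rewrite inv_sqrt_integral_quartic//.
  rewrite /polar /quad !(mul0r, mulr0, add0r, mulr1).
  by rewrite biquadratic_period21 -EFinM ltry.
pose k := (Num.sqrt (quad p q s c))^-1.
have ikg : lebesgue_measure.-integrable `]a, b[ (fun x => (k%:E * (g x)%:E)%E).
  exact: integrableZl.
apply: le_integrable ikg => //.
- exact/measurable_EFinP.
- move=> x /=; rewrite in_itv/= => xab.
  rewrite lee_fin !ger0_norm ?mulr_ge0 ?invr_ge0 ?sqrtr_ge0// /g.
  rewrite -invfM -sqrtrM; last exact: ltW.
  have gx0 : 0 < quad p q s c * ((x - a) * (b - x) * quad 0 0 1 x).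
    by rewrite mulr_gt0 ?V0.
  rewrite lef_pV2 ?posrE ?sqrtr_gt0 ?W0//.
  rewrite ler_wsqrtr// /quad !mul0r !add0r mulr1 mulrC ler_wpM2l//.
    by move: xab => /andP[ax xb]; apply: mulr_ge0; rewrite subr_ge0; exact: ltW.
  by apply: cmin; move: xab => /andP[ax xb]; rewrite in_itv/= !ltW.
Qed.

(** * Connected components of subsets of the line *)

Lemma segment_inj (R : realType) (a b a' b' : R) :
  a <= b -> a' <= b' -> `[a, b]%classic = `[a', b']%classic ->
  a = a' /\ b = b'.
Proof.
move=> ab ab' E.
have sub x : (a <= x <= b) = (a' <= x <= b').
  have := congr1 (fun S => S x) E; rewrite /= !in_itv/=.
  by move=> /propeqP h; apply/idP/idP; apply h.
have := sub a; have := sub b; have := sub a'; have := sub b'.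
rewrite !lexx ab ab' !andbT => /andP[? ?] /andP[? ?].
move=> /esym /andP[? ?] /esym /andP[? ?].
by split; apply/eqP; rewrite eq_le; apply/andP.
Qed.

(** Connected sets of reals are intervals, so that a component cannot extend
    beyond a point having points outside S arbitrarily close on its far
    side. *)
Lemma connected_component_segment (R : realType) (S : set R) (a b x : R) :
  `[a, b] `<=` S ->
  (forall y, y < a -> exists2 z, y <= z < a & ~ S z) ->
  (forall y, b < y -> exists2 z, b < z <= y & ~ S z) ->
  a <= x <= b -> connected_component S x = `[a, b]%classic.
Proof.
move=> abS gapl gapr /andP[ax xb].
have Cx : connected_component S x x.
  by apply: connected_component_refl; apply: abS; rewrite /= in_itv/= ax.
have /connected_intervalP itvC := @component_connected _ S x.
have CS := @connected_component_sub _ S x.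
apply/seteqP; split=> [y Cy|].
  rewrite /= in_itv/= !leNgt; apply/andP; split; apply/negP.
    move=> /gapl[z /andP[yz za]]; apply; apply: CS.
    by apply: (itvC _ _ Cy Cx); rewrite yz (le_trans (ltW za)).
  move=> /gapr[z /andP[bz zy]]; apply; apply: CS.
  by apply: (itvC _ _ Cx Cy); rewrite zy (le_trans xb (ltW bz)).
apply: connected_component_max => //; first by rewrite /= in_itv/= ax.
exact: segment_connected.
Qed.

(** Either segment may be reduced to a point: this covers the isolated point 1
    of the allowed sets. *)
Lemma nondegenerate_component_segments (R : realType) (S : set R)
    (a b c d : R) :
  a <= b -> b < c -> c <= d ->
  (forall x, S x <-> a <= x <= b \/ c <= x <= d) ->
  forall a' b', nondegenerate_component S a' b' <->
    a' < b' /\ (a' = a /\ b' = b \/ a' = c /\ b' = d).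
Proof.
move=> ab bc cd SE a' b'.
have compl x : a <= x <= b -> connected_component S x = `[a, b]%classic.
  apply: connected_component_segment.
  - by move=> y /=; rewrite in_itv/= => yab; apply/SE; left.
  - move=> y ya; exists y; first by rewrite lexx.
    by move=> /SE[]/andP[]; lra.
  - move=> y yb; exists (Num.min y ((b + c) / 2)).
      by rewrite lt_min yb ge_min lexx/= andbT; lra.
    have : b < Num.min y ((b + c) / 2) by rewrite lt_min yb/=; lra.
    have : Num.min y ((b + c) / 2) < c by rewrite gt_min; apply/orP; right; lra.
    by move: (Num.min _ _) => z zc bz /SE[]/andP[]; lra.
have compr x : c <= x <= d -> connected_component S x = `[c, d]%classic.
  apply: connected_component_segment.
  - by move=> y /=; rewrite in_itv/= => yab; apply/SE; right.
  - move=> y yc; exists (Num.max y ((b + c) / 2)).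
      by rewrite gt_max yc le_max lexx/=; lra.
    have : Num.max y ((b + c) / 2) < c by rewrite gt_max yc/=; lra.
    have : b < Num.max y ((b + c) / 2) by rewrite lt_max; apply/orP; right; lra.
    by move: (Num.max _ _) => z bz zc /SE[]/andP[]; lra.
  - move=> y yd; exists y; first by rewrite lexx yd.
    by move=> /SE[]/andP[]; lra.
split=> [[ab' E]|[ab' [] [Ea Eb]]]; last 2 first.
- by subst; split=> //; apply: compl; rewrite lexx.
- by subst; split=> //; apply: compr; rewrite lexx.
split=> //.
have Sa' : S a'.
  apply: (@connected_component_sub _ S a'); rewrite E /= in_itv/= lexx.
  exact: ltW.
move: Sa' => /SE[/compl|/compr]; rewrite E => /segment_inj[];
  rewrite ?(ltW ab')//; by [left|right].
Qed.

Lemma nondegenerate_component_segment (R : realType) (S : set R) (a b : R) :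
  a < b -> (forall x, S x <-> a <= x <= b) ->
  forall a' b', nondegenerate_component S a' b' <-> a' = a /\ b' = b.
Proof.
move=> ab SE a' b'.
have comp x : a <= x <= b -> connected_component S x = `[a, b]%classic.
  apply: connected_component_segment.
  - by move=> y /=; rewrite in_itv/= => yab; apply/SE.
  - move=> y ya; exists y; first by rewrite lexx.
    by move=> /SE/andP[]; lra.
  - move=> y yb; exists y; first by rewrite lexx yb.
    by move=> /SE/andP[]; lra.
split=> [[ab' E]|[-> ->]]; last by split=> //; apply: comp; rewrite lexx ltW.
have /SE/comp : S a'.
  apply: (@connected_component_sub _ S a'); rewrite E /= in_itv/= lexx.
  exact: ltW.
by rewrite E => /segment_inj[]; rewrite ?ltW.
Qed.

(** * Comparison of the invariants *)

Lemma period_integral (R : realType) (W : R -> R) (k a b p q s : R) :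
  0 < k -> a < b -> (forall x, a <= x <= b -> 0 < quad p q s x) ->
  (forall x, W x = k * ((x - a) * (b - x) * quad p q s x)) ->
  well_defined W a b /\
  (2%:E * inv_sqrt_integral W a b)%E =
  ((4 * Num.sqrt k^-1)%:E *
   biquadratic_period (polar p q s a b) (quad p q s a * quad p q s b))%E.
Proof.
move=> k0 ab Q0 WE; have [V0 iV] := @well_defined_quartic R a b p q s ab Q0.
have sE x : ((Num.sqrt (W x))^-1)%:E =
    ((Num.sqrt k^-1)%:E *
     ((Num.sqrt ((x - a) * (b - x) * quad p q s x))^-1)%:E)%E.
  by rewrite WE sqrtrM ?ltW// invfM sqrtrV// ltW.
have sEf := funext sE.
split.
  split; first by move=> x /V0 V0x; rewrite WE mulr_gt0.
  by rewrite sEf; exact: integrableZl.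
rewrite {1}/inv_sqrt_integral sEf integralZl//.
rewrite -/(inv_sqrt_integral (fun x => (x - a) * (b - x) * quad p q s x) a b).
rewrite inv_sqrt_integral_quartic// !muleA -!EFinM.
by congr (_%:E * _)%E; ring.
Qed.

Section Periods.
Context {R : realType}.
Variables (v0 M d f : R).
Hypotheses (v0_gt0 : 0 < v0) (M_ge0 : 0 <= M) (d_gt0 : 0 < d).

Let k := v0 / (2 * d).
Let k_gt0 : 0 < k. Proof. by rewrite divr_gt0// mulr_gt0. Qed.
Let kV : k^-1 = 2 * d / v0. Proof. by rewrite /k invf_div. Qed.

Lemma Wp_up_radicand x : Wp v0 M d f x = k * up_radicand M d f x.
Proof.
rewrite /Wp /Wplus /J0_of /F0_of /up_radicand /k; field.
by rewrite !gt_eqF.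
Qed.

Lemma Wm_up_radicand x : Wm v0 M d f x = k * up_radicand M d f x.
Proof.
rewrite /Wm /Wminus /J0_of /F0_of /up_radicand /k; field.
by rewrite !gt_eqF.
Qed.

(** If d <= 2 M the vertex 2 M / d of q is at least 1, and q is positive on
    [-1, 1] because q(1) = 4 (f - M d) > 0; otherwise f lies above the value for
    which q has a double root. *)
Lemma up_quad_gt0 x : f_sep M d < f -> -1 <= x <= 1 ->
  0 < quad (d ^+ 2) (- 4 * d * M) (4 * f - d ^+ 2) x.
Proof.
rewrite /f_sep /quad => + /andP[x1 x2]; case: ifPn => [dM fMd|_ fM].
  have -> : d ^+ 2 * x ^+ 2 + - 4 * d * M * x + (4 * f - d ^+ 2) =
     d * ((1 - x) * (2 * (2 * M - d) + d * (1 - x))) + 4 * (f - M * d) by ring.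
  rewrite ltr_wpDl//; last by rewrite mulr_gt0// subr_gt0.
  rewrite mulr_ge0 ?(ltW d_gt0)// mulr_ge0// ?subr_ge0// addr_ge0//.
    by rewrite mulr_ge0// subr_ge0.
  by rewrite mulr_ge0 ?subr_ge0// ltW.
have -> : d ^+ 2 * x ^+ 2 + - 4 * d * M * x + (4 * f - d ^+ 2) =
     (d * x - 2 * M) ^+ 2 + 4 * (f - (M ^+ 2 + d ^+ 2 / 4)) by field.
by rewrite ltr_wpDl ?sqr_ge0// mulr_gt0// subr_gt0.
Qed.

Lemma f_sep_le : f_sep M d <= M ^+ 2 + d ^+ 2 / 4.
Proof.
rewrite /f_sep; case: ifPn => // _; rewrite -subr_ge0.
have -> : M ^+ 2 + d ^+ 2 / 4 - M * d = (M - d / 2) ^+ 2 by field.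
exact: sqr_ge0.
Qed.

(** For f < M d and z > 0 the polynomial exceeds (M z - d)^2.  For M d <= f one
    has 2 M < d, and the polynomial decreases on [0, 2] to its value
    4 M^2 + d^2 - 4 f > 0 at 2; the second identity below makes this visible as
    a combination of nonnegative quantities. *)
Lemma down_quad_gt0 z : f < f_sep M d -> 0 <= z <= 2 ->
  0 < quad (M ^+ 2) (- 2 * f) (d ^+ 2) z.
Proof.
move=> fs /andP[z0 z2]; have := z0; rewrite le_eqVlt => /predU1P[<-|z_gt0].
  by rewrite /quad expr0n !mulr0 !add0r exprn_gt0.
have [fMd|Mdf] := ltP f (M * d).
  have -> : quad (M ^+ 2) (- 2 * f) (d ^+ 2) z =
      (M * z - d) ^+ 2 + 2 * ((M * d - f) * z) by rewrite /quad; ring.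
  by rewrite ltr_wpDl ?sqr_ge0// !mulr_gt0// subr_gt0.
move: fs; rewrite /f_sep; case: ifPn => [_|]; first by rewrite ltNge Mdf.
rewrite -ltNge => Md fs.
have -> : quad (M ^+ 2) (- 2 * f) (d ^+ 2) z =
    2 * ((M ^+ 2 + d ^+ 2 / 4 - f) * z) +
    (2 - z) * ((d ^+ 2 / 4 - M ^+ 2) * 2 + M ^+ 2 * (2 - z)).
  by rewrite /quad; field.
rewrite ltr_wpDr ?mulr_gt0 ?subr_gt0// mulr_ge0 ?subr_ge0// addr_ge0//.
  rewrite mulr_ge0// subr_ge0 ler_pdivlMr//.
  have -> : M ^+ 2 * 4 = (2 * M) ^+ 2 by ring.
  by rewrite ler_sqr ?nnegrE ?mulr_ge0// ltW.
by rewrite mulr_ge0 ?sqr_ge0// subr_ge0.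
Qed.

Lemma up_radicandE x : up_radicand M d f x =
  (x - -1) * (1 - x) * quad (d ^+ 2) (- 4 * d * M) (4 * f - d ^+ 2) x.
Proof. by rewrite /up_radicand /quad; ring. Qed.

Lemma down_radicandE z : down_radicand M d f z =
  (z - 0) * (2 - z) * quad (M ^+ 2) (- 2 * f) (d ^+ 2) z.
Proof. by rewrite /down_radicand /quad; ring. Qed.

Lemma well_defined_up : f_sep M d < f ->
  well_defined (up_radicand M d f) (-1) 1.
Proof.
move=> fs; rewrite (funext up_radicandE); apply: well_defined_quartic.
  by lra.
by move=> x; exact: up_quad_gt0.
Qed.

Lemma well_defined_down : f < f_sep M d ->
  well_defined (down_radicand M d f) 0 2.
Proof.
move=> fs; rewrite (funext down_radicandE); apply: well_defined_quartic => //.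
by move=> x; exact: down_quad_gt0.
Qed.

Lemma theta_upE : f_sep M d < f -> theta_up v0 M d f =
  ((4 * Num.sqrt k^-1)%:E *
   biquadratic_period (8 * f - 4 * d ^+ 2) (16 * (f ^+ 2 - (M * d) ^+ 2)))%E.
Proof.
move=> fs; rewrite /theta_up (funext up_radicandE) inv_sqrt_integral_quartic.
- rewrite muleA -EFinM kV mulrAC -natrM.
  by congr (_ * biquadratic_period _ _)%E; rewrite /polar /quad; ring.
- by lra.
- by move=> x; exact: up_quad_gt0.
Qed.

(** Below, M and f are expressed through the roots e1 and e2 of q, which makes
    each comparison of invariants a polynomial identity. *)
Section Roots.
Variables (e1 e2 : R).
Hypotheses (sum_roots : d * (e1 + e2) = 4 * M)
  (prod_roots : d ^+ 2 * (e1 * e2) = 4 * f - d ^+ 2).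

Let ME : M = d * (e1 + e2) / 4. Proof. by rewrite sum_roots; field. Qed.
Let fE : f = d ^+ 2 * (1 + e1 * e2) / 4.
Proof. by rewrite mulrDr prod_roots; field. Qed.

Lemma up_radicand_roots x :
  up_radicand M d f x = d ^+ 2 * ((1 - x ^+ 2) * ((x - e1) * (x - e2))).
Proof. by rewrite /up_radicand ME fE; field. Qed.

(** Landen's transformation with r = d^2 (e2 - e1) / 2 brings the integral over
    [0, 2] to the form found directly on the intervals between roots of U. *)
Lemma theta_downE : f < f_sep M d -> -1 < e1 < 1 -> e1 < e2 ->
  theta_down v0 M d f =
  ((4 * Num.sqrt k^-1)%:E *
   biquadratic_period (d ^+ 2 * (1 - e1 * e2 + 3 * (e2 - e1)))
     (2 * d ^+ 4 * (e2 - e1) * (1 - e1) * (1 + e2)))%E.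
Proof.
move=> fs /andP[e1l e1r] e12.
rewrite /theta_down (funext down_radicandE).
rewrite inv_sqrt_integral_quartic//; last first.
  by move=> x; exact: down_quad_gt0.
set m := polar _ _ _ _ _.
pose r := d ^+ 2 * (e2 - e1) / 2.
have mE : m = d ^+ 2 * (1 - e1 * e2).
  by rewrite /m /polar fE; field.
have r0 : 0 < r by rewrite !mulr_gt0 ?exprn_gt0 ?invr_gt0 ?subr_gt0.
have mr : m + 2 * r = d ^+ 2 * ((1 - e1) * (1 + e2)) by rewrite mE /r; field.
have mr0 : 0 < m + 2 * r.
  by rewrite mr !mulr_gt0 ?exprn_gt0 ?subr_gt0//; lra.
have -> : quad (M ^+ 2) (- 2 * f) (d ^+ 2) 0 * quad (M ^+ 2) (- 2 * f) (d ^+ 2) 2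
    = r ^+ 2 by rewrite /quad /r ME fE; field.
rewrite biquadratic_period_landen// !muleA -!EFinM kV.
congr (_ * biquadratic_period _ _)%E.
- by congr EFin; ring.
- by rewrite mE /r; field.
- by rewrite mr /r; field.
Qed.

Lemma down_period_left (W : R -> R) :
  (forall x, W x = k * up_radicand M d f x) ->
  f < f_sep M d -> -1 < e1 < 1 -> e1 < e2 ->
  well_defined W (-1) e1 /\
  theta_down v0 M d f = (2%:E * inv_sqrt_integral W (-1) e1)%E.
Proof.
move=> WE fs /andP[e1l e1r] e12; rewrite theta_downE ?e1l//.
have [||wd ->] := @period_integral R W k (-1) e1 (d ^+ 2)
  (- d ^+ 2 * (1 + e2)) (d ^+ 2 * e2) k_gt0 e1l.
- move=> x /andP[x1 x2].
  rewrite (_ : quad _ _ _ _ = d ^+ 2 * ((1 - x) * (e2 - x))).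
    by rewrite !mulr_gt0 ?exprn_gt0 ?subr_gt0//; lra.
  by rewrite /quad; ring.
- by move=> x; rewrite WE up_radicand_roots /quad; ring.
by split=> //; congr (_ * biquadratic_period _ _)%E; rewrite /polar /quad; ring.
Qed.

Lemma down_period_right (W : R -> R) :
  (forall x, W x = k * up_radicand M d f x) ->
  f < f_sep M d -> -1 < e1 < 1 -> e1 < e2 -> e2 < 1 ->
  well_defined W e2 1 /\
  theta_down v0 M d f = (2%:E * inv_sqrt_integral W e2 1)%E.
Proof.
move=> WE fs /andP[e1l e1r] e12 e2r; rewrite theta_downE ?e1l//.
have [||wd ->] := @period_integral R W k e2 1 (d ^+ 2)
  (d ^+ 2 * (1 - e1)) (- d ^+ 2 * e1) k_gt0 e2r.
- move=> x /andP[x1 x2].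
  rewrite (_ : quad _ _ _ _ = d ^+ 2 * ((x + 1) * (x - e1))).
    by rewrite !mulr_gt0 ?exprn_gt0 ?subr_gt0//; lra.
  by rewrite /quad; ring.
- by move=> x; rewrite WE up_radicand_roots /quad; ring.
by split=> //; congr (_ * biquadratic_period _ _)%E; rewrite /polar /quad; ring.
Qed.

Lemma down_period_above (W : R -> R) :
  (forall x, W x = k * up_radicand M d f x) ->
  f < f_sep M d -> -1 < e1 < 1 -> 1 < e2 ->
  well_defined W 1 e2 /\
  theta_down v0 M d f = (2%:E * inv_sqrt_integral W 1 e2)%E.
Proof.
move=> WE fs /andP[e1l e1r] e2r.
have e12 := lt_trans e1r e2r; rewrite theta_downE ?e1l//.
have [||wd ->] := @period_integral R W k 1 e2 (d ^+ 2)
  (d ^+ 2 * (1 - e1)) (- d ^+ 2 * e1) k_gt0 e2r.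
- move=> x /andP[x1 x2].
  rewrite (_ : quad _ _ _ _ = d ^+ 2 * ((x + 1) * (x - e1))).
    by rewrite !mulr_gt0 ?exprn_gt0 ?subr_gt0//; lra.
  by rewrite /quad; ring.
- by move=> x; rewrite WE up_radicand_roots /quad; ring.
by split=> //; congr (_ * biquadratic_period _ _)%E; rewrite /polar /quad; ring.
Qed.

(** The intervals [e1, e2] and [-1, 1] are complementary pairs of roots of U;
    the product of the values of the quadratic factor at the end points is in
    both cases d^4 (e1^2 - 1) (e2^2 - 1). *)
Lemma up_period_above (W : R -> R) :
  (forall x, W x = k * up_radicand M d f x) ->
  f_sep M d < f -> 1 < e1 -> e1 < e2 ->
  well_defined W e1 e2 /\
  theta_up v0 M d f = (2%:E * inv_sqrt_integral W e1 e2)%E.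
Proof.
move=> WE fs e1r e12; rewrite theta_upE//.
have [||wd ->] := @period_integral R W k e1 e2 (d ^+ 2) 0 (- d ^+ 2) k_gt0 e12.
- move=> x /andP[x1 x2].
  rewrite (_ : quad _ _ _ _ = d ^+ 2 * ((x + 1) * (x - 1))).
    by rewrite !mulr_gt0 ?exprn_gt0 ?subr_gt0//; lra.
  by rewrite /quad; ring.
- by move=> x; rewrite WE up_radicand_roots /quad; ring.
by split=> //; congr (_ * biquadratic_period _ _)%E; rewrite /polar /quad
  ?fE ?ME; field.
Qed.

End Roots.

Lemma up_period (W : R -> R) :
  (forall x, W x = k * up_radicand M d f x) ->
  f_sep M d < f ->
  well_defined W (-1) 1 /\
  theta_up v0 M d f = (2%:E * inv_sqrt_integral W (-1) 1)%E.
Proof.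
move=> WE fs; rewrite theta_upE//.
have [|||wd ->] := @period_integral R W k (-1) 1 (d ^+ 2)
  (- 4 * d * M) (4 * f - d ^+ 2) k_gt0.
- by lra.
- by move=> x; exact: up_quad_gt0.
- by move=> x; rewrite WE up_radicandE.
by split=> //; congr (_ * biquadratic_period _ _)%E; rewrite /polar /quad; ring.
Qed.

(** Both roots of q exceed -1, because q(-1) = 4 (f + M d) > 0 and the vertex
    2 M / d is nonnegative. *)
Lemma real_roots : f < M ^+ 2 + d ^+ 2 / 4 -> - M * d < f ->
  exists e1 e2, [/\ d * (e1 + e2) = 4 * M,
    d ^+ 2 * (e1 * e2) = 4 * f - d ^+ 2, -1 < e1 & e1 < e2].
Proof.
move=> fl fg; have D0 : 0 < 4 * M ^+ 2 + d ^+ 2 - 4 * f by lra.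
pose S := Num.sqrt (4 * M ^+ 2 + d ^+ 2 - 4 * f).
have S0 : 0 < S by rewrite sqrtr_gt0.
have SE : S ^+ 2 = 4 * M ^+ 2 + d ^+ 2 - 4 * f by rewrite sqr_sqrtr// ltW.
have Sl : S < 2 * M + d.
  rewrite -ltr_sqr ?nnegrE ?addr_ge0 ?mulr_ge0// ?ltW// SE.
  by rewrite sqrrD exprMn; lra.
exists ((2 * M - S) / d), ((2 * M + S) / d); split.
- by field; rewrite gt_eqF.
- have -> : 4 * f = 4 * M ^+ 2 + d ^+ 2 - S ^+ 2 by rewrite SE; ring.
  by field; rewrite gt_eqF.
- by rewrite ltr_pdivlMr//; lra.
- by rewrite ltr_pM2r ?invr_gt0//; lra.
Qed.

End Periods.

(** * Location of the roots and allowed sets *)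

Lemma QQ_cases (R : realType) (M d f : R) : QQ M (d, f) ->
  (f_sep M d < f /\ (d, f) \in QQup M) \/
  (f < f_sep M d /\ ((d, f) \in QQup M) = false).
Proof.
move=> Qdf; have [_ _ /eqP] := Qdf; rewrite /= neq_lt => /orP[fs|sf].
  by right; split=> //; apply: memNset => -[_ /=]; rewrite ltNge (ltW fs).
by left; split=> //; apply: mem_set.
Qed.

(** Here q(1) = 4 (f - M d) < 0. *)
Lemma roots_straddle1 (R : realType) (M d f e1 e2 : R) : 0 < d ->
  d * (e1 + e2) = 4 * M -> d ^+ 2 * (e1 * e2) = 4 * f - d ^+ 2 ->
  e1 < e2 -> f < M * d -> e1 < 1 < e2.
Proof.
move=> d0 sumE prodE e12 fMd.
have : (e1 - 1) * (e2 - 1) < 0.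
  rewrite -(pmulr_rlt0 _ (exprn_gt0 2 d0)).
  have -> : d ^+ 2 * ((e1 - 1) * (e2 - 1)) =
      d ^+ 2 * (e1 * e2) - d * (d * (e1 + e2)) + d ^+ 2 by ring.
  rewrite prodE sumE; lra.
have [e1r|e1r] := leP 1 e1.
  by rewrite ltNge mulr_ge0// subr_ge0// (le_trans e1r)// ltW.
have [e2r|//] := leP e2 1.
by rewrite ltNge mulr_le0// subr_le0// ltW.
Qed.

(** Here q(1) > 0, and the mean 2 M / d of the roots is at least 1. *)
Lemma roots_gt1 (R : realType) (M d f e1 e2 : R) : 0 < d ->
  d * (e1 + e2) = 4 * M -> d ^+ 2 * (e1 * e2) = 4 * f - d ^+ 2 ->
  e1 < e2 -> d <= 2 * M -> M * d < f -> 1 < e1.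
Proof.
move=> d0 sumE prodE e12 dM Mdf.
have prod_gt0 : 0 < (e1 - 1) * (e2 - 1).
  rewrite -(pmulr_rgt0 _ (exprn_gt0 2 d0)).
  have -> : d ^+ 2 * ((e1 - 1) * (e2 - 1)) =
      d ^+ 2 * (e1 * e2) - d * (d * (e1 + e2)) + d ^+ 2 by ring.
  rewrite prodE sumE; lra.
have sum_ge2 : 2 <= e1 + e2 by rewrite -(ler_pM2l d0) sumE; lra.
have [e1r|//] := leP e1 1.
have e2r : 1 <= e2 by lra.
by move: prod_gt0; rewrite ltNge mulr_le0_ge0// ?subr_le0// subr_ge0.
Qed.

(** If d <= 2 M then q(1) < 0; otherwise the mean 2 M / d of the roots is less
    than 1. *)
Lemma root_lt1 (R : realType) (M d f e1 e2 : R) : 0 < d ->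
  d * (e1 + e2) = 4 * M -> d ^+ 2 * (e1 * e2) = 4 * f - d ^+ 2 ->
  e1 < e2 -> f < f_sep M d -> e1 < 1.
Proof.
move=> d0 sumE prodE e12; rewrite /f_sep; case: ifPn => [_ fMd|].
  by have /andP[] := roots_straddle1 _ _ _ _ _ _ d0 sumE prodE e12 fMd.
rewrite -ltNge => dM _; have : e1 + e2 < 2.
  by rewrite -(ltr_pM2l d0) sumE; lra.
lra.
Qed.

Section Sets.
Context {R : realType}.
Variables (v0 M d f : R).
Hypotheses (v0_gt0 : 0 < v0) (d_gt0 : 0 < d).

Lemma beta_set_up : f_sep M d < f ->
  forall x, beta_set v0 M d f x <-> -1 <= x <= 1.
Proof.
move=> fs x; split=> [[]//|xb]; split=> //.
rewrite Wm_up_radicand// up_radicandE.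
have [x1 x2] := andP xb; have Q0 := up_quad_gt0 _ _ _ d_gt0 _ fs xb.
rewrite mulr_ge0 ?(ltW (divr_gt0 _ _)) ?mulr_gt0// mulr_ge0 ?(ltW Q0)//.
by rewrite mulr_ge0// subr_ge0.
Qed.

Variables (e1 e2 : R).
Hypotheses (sum_roots : d * (e1 + e2) = 4 * M)
  (prod_roots : d ^+ 2 * (e1 * e2) = 4 * f - d ^+ 2).

Let U_ge0 (x : R) : (0 <= v0 / (2 * d) * up_radicand M d f x) =
  (0 <= (1 - x ^+ 2) * ((x - e1) * (x - e2))).
Proof.
rewrite (@up_radicand_roots _ _ _ _ _ _ sum_roots prod_roots).
rewrite pmulr_rge0; last by rewrite divr_gt0// mulr_gt0.
by rewrite pmulr_rge0// exprn_gt0.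
Qed.

Lemma alpha_set_down : e1 < 1 < e2 ->
  forall x, alpha_set v0 M d f x <-> 1 <= x <= e2.
Proof.
move=> /andP[e1r e2r] x; rewrite /alpha_set /= Wp_up_radicand// U_ge0.
rewrite [X in 0 <= X](_ : _ = (x - 1) * (x + 1) * (x - e1) * (e2 - x));
  last by ring.
split=> [[x1]|/andP[x1 x2]].
  move=> U0; rewrite x1 leNgt; apply/negP => xe2; move: U0; apply/negP.
  by rewrite -ltNge nmulr_llt0 ?subr_lt0// !mulr_gt0//; lra.
by split=> //; rewrite !mulr_ge0//; lra.
Qed.

Lemma alpha_set_up : 1 < e1 -> e1 < e2 ->
  forall x, alpha_set v0 M d f x <-> 1 <= x <= 1 \/ e1 <= x <= e2.
Proof.
move=> e1r e12 x; rewrite /alpha_set /= Wp_up_radicand// U_ge0.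
rewrite [X in 0 <= X](_ : _ = (x - 1) * (x + 1) * ((x - e1) * (e2 - x)));
  last by ring.
split=> [[x1 U0]|[/andP[x1 x2]|/andP[x1 x2]]].
- have [xr|xr] := leP x 1; first by left; rewrite x1.
  right; move: U0; rewrite pmulr_rge0; last by rewrite mulr_gt0//; lra.
  have [xe1|xe1] := ltP x e1.
    by rewrite nmulr_rge0 ?subr_lt0// subr_le0 leNgt (lt_trans xe1).
  have [//|xe2] := leP x e2.
  by rewrite nmulr_lge0 ?subr_lt0// subr_le0 leNgt (lt_trans e12).
- have -> : x = 1 by apply/eqP; rewrite eq_le x1 x2.
  by split=> //; rewrite subrr !mul0r.
- by split; [lra|rewrite !mulr_ge0//; lra].
Qed.

(** The minimum treats together the cases e2 < 1, where [e2, 1] is a second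
    component, and 1 <= e2, where 1 is an isolated point. *)
Lemma beta_set_down : -1 < e1 < 1 -> e1 < e2 ->
  forall x, beta_set v0 M d f x <->
  -1 <= x <= e1 \/ Num.min e2 1 <= x <= 1.
Proof.
move=> /andP[e1l e1r] e12 x; rewrite /beta_set /= Wm_up_radicand// U_ge0 ge_min.
rewrite [X in 0 <= X](_ : _ = (1 - x) * (x + 1) * ((e1 - x) * (e2 - x)));
  last by ring.
split=> [[/andP[x1 x2] U0]|[/andP[x1 x2]|/andP[/orP[x1|x1] x2]]].
- rewrite x1 x2 andbT /=; have [//|xe1] := leP x e1; first by left.
  right; have [//|xe2] := leP e2 x.
  move: x2; rewrite le_eqVlt => /predU1P[->|x2]; first exact: lexx.
  move: U0; rewrite pmulr_rge0; last by rewrite mulr_gt0//; lra.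
  rewrite nmulr_rge0 ?subr_lt0// subr_le0 => /le_lt_trans/(_ xe2).
  by rewrite ltxx.
- split; first by apply/andP; split; lra.
  by rewrite !mulr_ge0//; lra.
- split; first by apply/andP; split; lra.
  by apply: mulr_ge0; [apply: mulr_ge0; lra|apply: mulr_le0; lra].
- have -> : x = 1 by apply/eqP; rewrite eq_le x1 x2.
  by split; [rewrite lexx andbT; lra|rewrite subrr !mul0r].
Qed.

End Sets.

Lemma tau_plus_theta (R : realType) (v0 M d f : R) :
  0 < v0 -> 0 <= M -> QQ M (d, f) -> f < f_plus M d ->
  is_tau_plus v0 M d f (theta v0 M d f).
Proof.
move=> v00 M0 Qdf fp; have [d0 fg _] := Qdf; rewrite /= in d0 fg.
rewrite /theta; case: (QQ_cases _ _ _ _ Qdf) => -[fs ->].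
(* Above the separatrix the upper bound on f forces d <= 2 M. *)
- have [dM fM] : d <= 2 * M /\ f < M ^+ 2 + d ^+ 2 / 4.
    move: fs fp; rewrite /f_sep /f_plus; case: ifPn => // _ fs fp.
    have := lt_trans fs fp; rewrite -subr_gt0.
    have -> : M * d - (M ^+ 2 + d ^+ 2 / 4) = - (M - d / 2) ^+ 2 by field.
    by rewrite oppr_gt0 ltNge sqr_ge0.
  have Mdf : M * d < f by move: fs; rewrite /f_sep dM.
  have [e1 [e2 [sumE prodE e1l e12]]] := real_roots _ _ _ M0 d0 fM fg.
  have e1r := roots_gt1 _ _ _ _ _ _ d0 sumE prodE e12 dM Mdf.
  have WE := Wp_up_radicand _ M _ f v00 d0.
  have [wd tE] :=
    up_period_above v0 M d f v00 d0 e1 e2 sumE prodE _ WE fs e1r e12.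
  exists e1, e2; split=> // a' b'.
  have SE := alpha_set_up v0 M d f v00 d0 e1 e2 sumE prodE e1r e12.
  have comp := nondegenerate_component_segments _ _ _ _ _ _
    (lexx 1) e1r (ltW e12) SE.
  rewrite comp.
  split=> [[ab' [[aE bE]|//]]|[-> ->]]; last by split=> //; right.
  by move: ab'; rewrite aE bE ltxx.
- have fMd : f < M * d by move: fs fp; rewrite /f_sep /f_plus; case: ifP.
  have fM := lt_le_trans fs (f_sep_le M d).
  have [e1 [e2 [sumE prodE e1l e12]]] := real_roots _ _ _ M0 d0 fM fg.
  have e1r := roots_straddle1 _ _ _ _ _ _ d0 sumE prodE e12 fMd.
  have WE := Wp_up_radicand _ M _ f v00 d0.
  have [e1r1 e2r] := andP e1r.
  have e1b : -1 < e1 < 1 by rewrite e1l.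
  have [wd tE] :=
    down_period_above v0 M d f v00 M0 d0 e1 e2 sumE prodE _ WE fs e1b e2r.
  exists 1, e2; split=> //.
  apply: nondegenerate_component_segment => //.
  exact: (alpha_set_down v0 M d f v00 d0 e1 e2 sumE prodE e1r).
Qed.

Lemma tau_minus_theta (R : realType) (v0 M d f : R) :
  0 < v0 -> 0 <= M -> QQ M (d, f) ->
  is_tau_minus v0 M d f (theta v0 M d f).
Proof.
move=> v00 M0 Qdf; have [d0 fg _] := Qdf; rewrite /= in d0 fg.
have WE := Wm_up_radicand _ M _ f v00 d0.
rewrite /theta; case: (QQ_cases _ _ _ _ Qdf) => -[fs ->].
- have N11 : -1 < 1 :> R by lra.
  have comp := nondegenerate_component_segment _ _ _ _ N11
    (beta_set_up v0 M d f v00 d0 fs).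
  split; first by exists (-1), 1; apply/comp.
  by move=> a b /comp[-> ->]; apply: up_period.
- have fM := lt_le_trans fs (f_sep_le M d).
  have [e1 [e2 [sumE prodE e1l e12]]] := real_roots _ _ _ M0 d0 fM fg.
  have e1r := root_lt1 _ _ _ _ _ _ d0 sumE prodE e12 fs.
  have e1b : -1 < e1 < 1 by rewrite e1l.
  have e1m : e1 < Num.min e2 1 by rewrite lt_min e12.
  have m1 : Num.min e2 1 <= 1 by rewrite ge_min lexx orbT.
  have comp := nondegenerate_component_segments _ _ _ _ _ _ (ltW e1l) e1m m1
    (beta_set_down v0 M d f v00 d0 e1 e2 sumE prodE e1b e12).
  split; first by exists (-1), e1; apply/comp; split=> //; left.
  move=> a b /comp[ab [[aE bE]|[aE bE]]].
    by rewrite aE bE; apply: (down_period_left v0 M d f v00 M0 d0 e1 e2).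
  have e2r : e2 < 1.
    by move: ab; rewrite aE bE gt_min ltxx orbF.
  rewrite aE bE min_l ?(ltW e2r)//.
  exact: (down_period_right v0 M d f v00 M0 d0 e1 e2).
Qed.

Theorem theorem1p1 (R : realType) (v0 Mm Mp : R)
  (v0_gt0 : 0 < v0) (Mm_ge0 : 0 <= Mm) (Mm_le_Mp : Mm <= Mp)
  (M_neq0 : (Mm, Mp) <> (0, 0)) :
  (forall M : R, M = Mm \/ M = Mp ->
     forall d f : R, QQ M (d, f) -> theta_well_defined M d f) /\
  (forall d f : R, PP Mm Mp (d, f) ->
     is_tau_plus v0 Mp d f (theta v0 Mp d f) /\
     is_tau_minus v0 Mm d f (theta v0 Mm d f)).
Proof.
have Mp_ge0 : 0 <= Mp by exact: le_trans Mm_le_Mp.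
split=> [M MmMp d f Qdf|d f [/= d0 /andP[fl fr] fm fp]].
  have M0 : 0 <= M by case: MmMp => ->.
  have [d0 _ _] := Qdf; rewrite /= in d0.
  rewrite /theta_well_defined; case: (QQ_cases _ _ _ _ Qdf) => -[fs ->].
    exact: well_defined_up.
  exact: well_defined_down.
split; last exact: tau_minus_theta.
(* The lower bound for f at M_- implies the one at M_+. *)
apply: tau_plus_theta => //; split=> //=.
apply: le_lt_trans fl; rewrite /f_minus !mulNr lerN2.
by rewrite ler_wpM2r// ltW.
Qed.
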